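(* Let $\mathbb{K}=\mathbb{Q}[\omega]$ with $\omega$ a primitive third root of unity, and let $\mathcal{S}_G$ be the set of 3-dimensional complex subspaces $V_+\subset\mathbb{C}^6=\mathbb{K}^6\otimes_{\mathbb{Q}}\mathbb{R}$ on which $H$ is positive definite. To each $V_+\in\mathcal{S}_G$ associate the representation $h_3=h_{3,V_+}$ of $\mathbb{C}^*$ on $(\bigwedge^3_{\mathbb{K}}\mathbb{K}^6)\otimes_{\mathbb{Q}}\mathbb{R}$ (a Hodge structure of weight $3$). Then for $g\in SU(3,3)=SU(H)$, with $g_3=\bigwedge^3g$, one has $$h_{3,gV_+}(z)=g_3\,h_{3,V_+}(z)\,g_3^{-1}\qquad(z\in\mathbb{C}^* ),$$ so $SU(3,3)$ acts on the set of Hodge structures of weight $3$ of this form on $\bigwedge^3\mathbb{K}^6$; the stabilizer of any $h_{3,V_+}$ is isomorphic to $S(U(3)\times U(3))$. Hence the moduli space of these Hodge structures of weight $3$ on $\bigwedge^3\mathbb{K}^6$ is $SU(3,3)/S(U(3)\times U(3))$.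
   Context: Fix an embedding $\mathbb{K}\subset\mathbb{C}$. $H(v,w)=\sum_{j=1}^6\epsilon_j\overline{v_j}w_j$ on $\mathbb{C}^6$, with $\epsilon_1=\epsilon_2=\epsilon_3=1$ and $\epsilon_4=\epsilon_5=\epsilon_6=-1$; $SU(H)$ is the group of determinant-one complex linear maps preserving $H$. $S(U(3)\times U(3))$ is the group of pairs $(A',A'')\in U(3)\times U(3)$ with $\det A'\det A''=1$. For $V_+\in\mathcal{S}_G$ let $V_-=V_+^\perp$ (with respect to $H$), let $J=J_{V_+}$ be the $\mathbb{C}$-linear map acting as $i$ on $V_+$ and $-i$ on $V_-$, let $h_{V_+}(a+bi)=a\,\mathrm{Id}+bJ$ on $\mathbb{C}^6$, and let $h_{3,V_+}(z)=\bigwedge^3h_{V_+}(z)$ on $(\bigwedge^3_{\mathbb{K}}\mathbb{K}^6)\otimes_{\mathbb{Q}}\mathbb{R}=\bigwedge^3_{\mathbb{C}}\mathbb{C}^6$. The Hodge structures of weight 3 considered are the ones given by the representations $h_{3,V_+}$, $V_+\in\mathcal{S}_G$, and their moduli space is the set of all of them. *)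

(* Defs.v *)
From HB Require Import structures.
From mathcomp Require Import all_boot all_order all_fingroup all_algebra.
From mathcomp Require Import all_classical reals.
From mathcomp Require Import complex ring.

Set Implicit Arguments.
Unset Strict Implicit.
Unset Printing Implicit Defensive.

Import Order.TTheory GRing.Theory Num.Theory.
Local Open Scope classical_set_scope.
Local Open Scope ring_scope.
Local Open Scope sesquilinear_scope.

(** Increasing maps t : {0..k-1} -> {0..n-1}. They index the basis
    e_t = e_(t 0) /\ ... /\ e_(t (k-1)) of the k-th exterior power of F^n. *)
Definition incr (k n : nat) : predArgType :=
  {t : {ffun 'I_k -> 'I_n} | [forall i : 'I_k, forall j : 'I_k, (i < j)%N ==> (t i < t j)%N]}.

HB.instance Definition _ k n := Finite.on (incr k n).

(** dim of the k-th exterior power of F^n; the space itself is 'cV[F]_(extdim k n). *)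
Definition extdim (k n : nat) : nat := #|{: incr k n}|.

Definition incr_of k n (i : 'I_(extdim k n)) : 'I_k -> 'I_n := val (enum_val i).

(** M_0 /\ ... /\ M_(k-1) for the columns M_j of M: its e_t-coordinate is the
    minor of M on the rows t. *)
Definition wedge (F : comNzRingType) k n (M : 'M[F]_(n, k)) : 'cV[F]_(extdim k n) :=
  \col_i \det (rowsub (incr_of i) M).

(** k-th exterior power of A : F^n -> F^n, as a matrix in the basis e_t:
    the column of index t is A e_(t 0) /\ ... /\ A e_(t (k-1)). *)
Definition extpow (F : comNzRingType) k n (A : 'M[F]_n) : 'M[F]_(extdim k n) :=
  \matrix_(i, j) wedge (colsub (incr_of j) A) i 0.

Section ExteriorPower.
Variables (F : comNzRingType) (k n : nat).
Implicit Types (A B : 'M[F]_n) (M : 'M[F]_(n, k)).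

Lemma incr_of_ltn (s : 'I_(extdim k n)) (i j : 'I_k) :
  (i < j)%N -> (incr_of s i < incr_of s j)%N.
Proof. by move=> ij; have /forallP/(_ i)/forallP/(_ j)/implyP := valP (enum_val s); exact. Qed.

Lemma incr_of_inj (s : 'I_(extdim k n)) : injective (incr_of s).
Proof.
move=> i j e; apply/val_inj => /=; case: (ltngtP i j) => // /(incr_of_ltn s);
by rewrite e ltnn.
Qed.

Lemma incr_of_sorted (s : 'I_(extdim k n)) :
  sorted ltn [seq val (incr_of s i) | i <- enum 'I_k].
Proof.
rewrite sorted_map; have: sorted (fun i j : 'I_k => (i < j)%N) (enum 'I_k).
  by rewrite -(@sorted_map _ _ val ltn) val_enum_ord iota_ltn_sorted.
by apply: sub_sorted => i j; exact: incr_of_ltn.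
Qed.

Lemma incr_of_perm_inj (s1 s2 : 'I_(extdim k n)) (p1 p2 : 'S_k) :
  incr_of s1 \o p1 =1 incr_of s2 \o p2 -> s1 = s2 /\ p1 = p2.
Proof.
move=> e.
have es : s1 = s2.
  apply: enum_val_inj; apply: val_inj; apply/ffunP => i.
  pose f (s : 'I_(extdim k n)) := [seq val (incr_of s i) | i <- enum 'I_k].
  have fp s (p : 'S_k) : perm_eq (f s) [seq val (incr_of s (p i)) | i <- enum 'I_k].
    rewrite /f (map_comp (fun i => val (incr_of s i)) p); apply: perm_map.
    apply: uniq_perm; rewrite ?(map_inj_uniq perm_inj) ?enum_uniq // => j.
    by rewrite mem_enum; apply/esym/mapP; exists ((p^-1)%g j); rewrite ?mem_enum ?permKV.
  have ff : f s1 = f s2.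
    apply: (sorted_eq ltn_trans); rewrite ?incr_of_sorted //.
      by move=> x y /andP[/ltnW xy /ltnW yx]; apply/eqP; rewrite eqn_leq xy yx.
    apply: (perm_trans (fp s1 p1)); rewrite perm_sym.
    rewrite (eq_map (g := fun j => val (incr_of s2 (p2 j)))) ?fp // => j.
    by congr val; exact: e.
  have fi s (j : 'I_k) : nth 0%N (f s) j = incr_of s j.
    have jk : (j < size (enum 'I_k))%N by rewrite size_enum_ord.
    by rewrite (nth_map j) // nth_ord_enum.
  by apply: val_inj; rewrite -[LHS](fi s1) -[RHS](fi s2) ff.
split=> //; apply/permP => i; apply: (@incr_of_inj s1).
by have := e i; rewrite /= -es.
Qed.

Lemma incr_of_perm_surj (f : {ffun 'I_k -> 'I_n}) : injective f ->
  exists (s : 'I_(extdim k n)) (p : 'S_k), f =1 incr_of s \o p.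
Proof.
move=> finj.
pose l := sort (fun i j : 'I_n => (i <= j)%N) [seq f i | i <- enum 'I_k].
have sl : size l = k by rewrite size_sort size_map size_enum_ord.
have ul : uniq l by rewrite sort_uniq (map_inj_uniq finj) enum_uniq.
have lsort : sorted (fun i j : 'I_n => (i < j)%N) l.
  rewrite -(@sorted_map _ _ val ltn) ltn_sorted_uniq_leq (map_inj_uniq val_inj) ul /=.
  by rewrite sorted_map; apply: sort_sorted => i j; exact: leq_total.
have fl i : f i \in l by rewrite mem_sort; apply/mapP; exists i; rewrite ?mem_enum.
have il i : (index (f i) l < k)%N by rewrite -[k in leqRHS]sl index_mem.
case: (posnP k) => [k0|k0].
  have noI (i : 'I_k) : False by move: (ltn_ord i) => /=; rewrite [X in (_ < X)%N]k0.
  have ti : [forall i : 'I_k, forall j : 'I_k, (i < j)%N ==> (f i < f j)%N].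
    by apply/forallP => i; case: (noI i).
  by exists (enum_rank (exist _ f ti : incr k n)), 1%g => i; case: (noI i).
pose x0 := f (Ordinal k0).
pose t : {ffun 'I_k -> 'I_n} := [ffun i : 'I_k => nth x0 l i].
have ti : [forall i : 'I_k, forall j : 'I_k, (i < j)%N ==> (t i < t j)%N].
  apply/forallP => i; apply/forallP => j; apply/implyP => ij; rewrite !ffunE.
  apply: (sorted_ltn_nth _ x0 lsort); rewrite ?inE ?sl //.
  by move=> a b c; exact: ltn_trans.
have pinj : injective (fun i => Ordinal (il i)).
  move=> i j /(congr1 val)/= e; apply: finj.
  by rewrite -[LHS](nth_index x0 (fl i)) e nth_index.
exists (enum_rank (exist _ t ti : incr k n)), (perm pinj) => i.
by rewrite /incr_of /= enum_rankK /= ffunE permE /= nth_index.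
Qed.

Lemma det_mulmx_minors (A : 'M[F]_(k, n)) (M : 'M[F]_(n, k)) :
  \det (A *m M) =
  \sum_(s < extdim k n) \det (colsub (incr_of s) A) * \det (rowsub (incr_of s) M).
Proof.
have -> : \det (A *m M) =
    \sum_(f : {ffun 'I_k -> 'I_n}) (\prod_i A i (f i)) * \det (rowsub f M).
  transitivity (\sum_(p : 'S_k) \sum_(f : {ffun 'I_k -> 'I_n})
     (-1) ^+ p * \prod_i (A i (f i) * M (f i) (p i))).
    apply: eq_bigr => p _; rewrite -big_distrr /=; congr (_ * _).
    under eq_bigr do rewrite mxE.
    exact: (bigA_distr_bigA (fun i j => A i j * M j (p i))).
  rewrite exchange_big /=; apply: eq_bigr => f _; rewrite /determinant big_distrr /=.
  apply: eq_bigr => p _; rewrite big_split /= mulrCA; congr (_ * (_ * _)).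
  by apply: eq_bigr => i _; rewrite !mxE.
rewrite (bigID (fun f : {ffun 'I_k -> 'I_n} => injectiveb f)) /= [X in _ + X]big1 ?addr0; last first.
  move=> f /injectivePn[i [j ij fij]].
  by rewrite (determinant_alternate ij) ?mulr0 // => l; rewrite !mxE fij.
pose h (x : 'I_(extdim k n) * 'S_k) : {ffun 'I_k -> 'I_n} := [ffun i => incr_of x.1 (x.2 i)].
have hinj : injective h.
  move=> [s1 p1] [s2 p2] /ffunP e.
  by have [|-> ->//] := @incr_of_perm_inj s1 s2 p1 p2; move=> i; have := e i; rewrite !ffunE.
rewrite (eq_bigl (fun f => f \in [set h x | x in [set: 'I_(extdim k n) * 'S_k]]%SET)); last first.
  move=> f; apply/injectiveP/imsetP => [/incr_of_perm_surj[s [p e]]|[[s p] _ ->] i j].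
    by exists (s, p) => //; apply/ffunP => i; rewrite ffunE e.
  by rewrite !ffunE => /incr_of_inj/perm_inj.
rewrite big_imset /=; last by move=> x y _ _; exact: hinj.
under eq_bigl do rewrite finset.in_setT.
rewrite -(pair_big xpredT xpredT (fun s p => (\prod_i A i (h (s, p) i)) * \det (rowsub (h (s, p)) M))) /=.
apply: eq_bigr => s _; rewrite [X in X * _]/determinant big_distrl /=; apply: eq_bigr => p _.
have -> : rowsub (h (s, p)) M = row_perm p (rowsub (incr_of s) M).
  by apply/matrixP => i j; rewrite !mxE ffunE.
rewrite row_permE det_mulmx det_perm mulrA; congr (_ * _); rewrite mulrC; congr (_ * _).
by apply: eq_bigr => i _; rewrite !mxE ffunE.
Qed.

(** (Lambda^k A) (v_1 /\ ... /\ v_k) = A v_1 /\ ... /\ A v_k. *)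
Lemma extpow_wedge A M : extpow k A *m wedge M = wedge (A *m M).
Proof.
apply/colP => i; rewrite !mxE.
have -> : rowsub (incr_of i) (A *m M) = rowsub (incr_of i) A *m M.
  by apply/matrixP => a b; rewrite !mxE; apply: eq_bigr => c _; rewrite !mxE.
rewrite det_mulmx_minors; apply: eq_bigr => s _; rewrite !mxE; congr (\det _ * _).
by apply/matrixP => a b; rewrite !mxE.
Qed.

Lemma wedge_basis (t : 'I_(extdim k n)) :
  wedge (colsub (incr_of t) (1%:M : 'M[F]_n)) = delta_mx t 0.
Proof.
apply/colP => s; rewrite !mxE eqxx andbT.
have -> : rowsub (incr_of s) (colsub (incr_of t) (1%:M : 'M[F]_n)) =
    \matrix_(i, j) (incr_of s i == incr_of t j)%:R.
  by apply/matrixP => i j; rewrite !mxE.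
have [->|st] := eqVneq s t.
  rewrite (_ : \matrix_(_, _) _ = 1%:M) ?det1 //.
  by apply/matrixP => i j; rewrite !mxE (inj_eq (@incr_of_inj t)).
rewrite /determinant big1 // => p _.
have [i /negbTE ne] : exists i, incr_of s i != incr_of t (p i).
  apply/existsP; apply: contraNT st; rewrite negb_exists => /forallP e.
  have [|-> //] := @incr_of_perm_inj s t 1%g p.
  by move=> i; apply/eqP; rewrite /= perm1 -[_ == _]negbK; exact: e.
by rewrite (bigD1 i) //= mxE ne mul0r mulr0.
Qed.

Lemma extpowM A B : extpow k (A *m B) = extpow k A *m extpow k B.
Proof.
apply/matrixP => i j.
have := extpow_wedge A (colsub (incr_of j) B) => /colP/(_ i) e.
rewrite [LHS]mxE -mulmx_colsub -e !mxE; apply: eq_bigr => l _.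
by rewrite ?mxE.
Qed.

Lemma extpow1 : extpow k (1%:M : 'M[F]_n) = 1%:M.
Proof. by apply/matrixP => i j; rewrite mxE wedge_basis !mxE andbT. Qed.

End ExteriorPower.

Definition Hsign (C : numClosedFieldType) (j : 'I_6) : C :=
  if (j < 3)%N then 1 else -1.

Definition Hform (C : numClosedFieldType) (v w : 'cV[C]_6) : C :=
  \sum_j Hsign C j * (v j 0)^* * w j 0.

Section Hform.
Variable C : numClosedFieldType.
Implicit Types (v w : 'cV[C]_6) (V : {vspace 'cV[C]_6}).

Lemma Hform_is_linear v : linear (Hform v : 'cV[C]_6 -> C^o).
Proof.
move=> a x y; rewrite /Hform scaler_sumr -big_split /=; apply: eq_bigr => j _.
by rewrite !mxE mulrDr; congr (_ + _); rewrite -mulrCA.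
Qed.

HB.instance Definition _ v :=
  GRing.isLinear.Build C 'cV[C]_6 C^o _ (Hform v) (Hform_is_linear v).

Lemma HformC v w : Hform w v = (Hform v w)^*.
Proof.
rewrite /Hform rmorph_sum; apply: eq_bigr => j _.
rewrite !rmorphM /= conjCK /Hsign; case: ifP => _; rewrite ?rmorphN rmorph1; ring.
Qed.

(** The orthogonal complement with respect to H (see [mem_orthv]). *)
Definition orthv V : {vspace 'cV[C]_6} :=
  lker (linfun (fun w => \col_(i < \dim V) Hform (vbasis V)`_i w)).

Lemma mem_orthv V w : w \in orthv V <-> (forall v, v \in V -> Hform v w = 0).
Proof.
have flin : linear (fun w => \col_(i < \dim V) Hform (vbasis V)`_i w).
  by move=> a x y; apply/colP => i; rewrite !mxE; exact: linearP.
pose fL := GRing.isLinear.Build C _ _ _ _ flin.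
pose f : {linear 'cV[C]_6 -> 'cV[C]_(\dim V)} := HB.pack (fun w => \col_(i < \dim V) Hform (vbasis V)`_i w) fL.
have -> : orthv V = lker (linfun f) by [].
rewrite memv_ker lfunE /=; split=> [/eqP/colP e v|e]; last first.
  by apply/eqP/colP => i; rewrite !mxE e // vbasis_mem // mem_nth // size_tuple.
move=> /coord_vbasis ->; rewrite HformC; apply/eqP; rewrite conjC_eq0; apply/eqP.
rewrite linear_sum big1 // => i _; rewrite linearZ /= HformC.
by have := e i; rewrite !mxE => ->; rewrite conjC0 scaler0.
Qed.

Definition posSpace : set {vspace 'cV[C]_6} :=
  [set V | \dim V = 3%N /\ forall v, v \in V -> v != 0 -> 0 < Hform v v].

Definition imv (g : 'M[C]_6) V : {vspace 'cV[C]_6} := (linfun (mulmx g) @: V)%VS.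

(** Multiplication by i on V and by -i on the H-orthogonal of V, when these are
    in direct sum: see [Jmx_pos] and [Jmx_neg]. *)
Definition Jend V : 'End('cV[C]_6) :=
  ('i *: daddv_pi V (orthv V) - 'i *: daddv_pi (orthv V) V)%VF.

Definition Jmx V : 'M[C]_6 := \matrix_(i, j) Jend V (delta_mx j 0) i 0.

Lemma JmxE V v : Jmx V *m v = Jend V v.
Proof.
apply/colP => i; rewrite [in RHS](matrix_sum_delta v) linear_sum summxE mxE.
apply: eq_bigr => j _; rewrite big_ord1 linearZ !mxE mulrC; congr (_ * _).
Qed.

Lemma posSpace_capv V : posSpace V -> (V :&: orthv V = 0)%VS.
Proof.
move=> [_ Vpos]; apply/eqP; rewrite -subv0; apply/subvP => v.
rewrite memv_cap memv0 => /andP[Vv /mem_orthv/(_ v Vv) v0].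
by apply: contraT => /(Vpos v Vv); rewrite v0 ltxx.
Qed.

Lemma Jmx_pos V v : posSpace V -> v \in V -> Jmx V *m v = 'i *: v.
Proof.
move=> /posSpace_capv V0 Vv; rewrite JmxE.
have e := daddv_pi_add V0 (subvP (addvSl V (orthv V)) _ Vv).
rewrite !lfun_simp /= daddv_pi_id // in e *.
by move/(canRL (addKr _)): e; rewrite addNr => ->; rewrite scaler0 subr0.
Qed.

Lemma Jmx_neg V v : posSpace V -> v \in orthv V -> Jmx V *m v = - ('i *: v).
Proof.
move=> /posSpace_capv V0 Vv; rewrite JmxE.
have e := daddv_pi_add V0 (subvP (addvSr V (orthv V)) _ Vv).
rewrite !lfun_simp /= [daddv_pi (orthv V) V v]daddv_pi_id 1?capvC // in e *.
by move/(canRL (addrK _)): e; rewrite subrr => ->; rewrite scaler0 sub0r.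
Qed.

Definition hmx V (z : C) : 'M[C]_6 := 'Re z *: 1%:M + 'Im z *: Jmx V.

End Hform.

Definition Cstar (C : fieldType) := {z : C | z != 0}.
HB.instance Definition _ (C : fieldType) := Choice.on (Cstar C).

Section Cstar.
Variable C : fieldType.
Implicit Types x y : Cstar C.

Definition cs_one : Cstar C := exist (fun z : C => z != 0) 1 (oner_neq0 C).
Definition cs_inv x : Cstar C := exist (fun z : C => z != 0) (val x)^-1 (invr_neq0 (valP x)).
Definition cs_mul x y : Cstar C :=
  exist (fun z : C => z != 0) _ (mulf_neq0 (valP x) (valP y)).

Fact cs_mulA : associative cs_mul.
Proof. by move=> x y z; apply/val_inj/mulrA. Qed.
Fact cs_mul1 : left_id cs_one cs_mul.
Proof. by move=> x; apply/val_inj/mul1r. Qed.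
Fact cs_mulr1 : right_id cs_one cs_mul.
Proof. by move=> x; apply/val_inj/mulr1. Qed.
Fact cs_mulV : left_inverse cs_one cs_inv cs_mul.
Proof. by move=> x; apply/val_inj/mulVf/(valP x). Qed.
Fact cs_mulrV : right_inverse cs_one cs_inv cs_mul.
Proof. by move=> x; apply/val_inj/mulfV/(valP x). Qed.

HB.instance Definition _ :=
  isGroup.Build (Cstar C) cs_mulA cs_mul1 cs_mulr1 cs_mulV cs_mulrV.
End Cstar.

Definition in_SUH (C : numClosedFieldType) (g : 'M[C]_6) : bool :=
  `[< \det g = 1 /\ forall v w, Hform (g *m v) (g *m w) = Hform v w >].

Definition SUH (C : numClosedFieldType) := {g : 'M[C]_6 | in_SUH g}.
HB.instance Definition _ (C : numClosedFieldType) := Choice.on (SUH C).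

Definition in_SU3U3 (C : numClosedFieldType) (p : 'M[C]_3 * 'M[C]_3) : bool :=
  [&& p.1 \is unitarymx, p.2 \is unitarymx & \det p.1 * \det p.2 == 1].

Definition SU3U3 (C : numClosedFieldType) := {p : 'M[C]_3 * 'M[C]_3 | in_SU3U3 p}.
HB.instance Definition _ (C : numClosedFieldType) := Choice.on (SU3U3 C).

Section SUH.
Variable C : numClosedFieldType.
Implicit Types g : SUH C.

Lemma SUH_unit g : val g \in unitmx.
Proof. by have /asboolP[d _] := valP g; rewrite unitmxE d unitr1. Qed.

Fact su_one_subproof : in_SUH (1%:M : 'M[C]_6).
Proof. by apply/asboolP; split=> [|v w]; rewrite ?det1 ?mul1mx. Qed.
Definition su_one : SUH C := exist (@in_SUH C) _ su_one_subproof.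

Fact su_inv_subproof g : in_SUH (invmx (val g)).
Proof.
have /asboolP[d gH] := valP g; apply/asboolP; split=> [|v w].
  by rewrite det_inv d invr1.
by rewrite -gH !mulmxA mulmxV ?SUH_unit // !mul1mx.
Qed.
Definition su_inv g : SUH C := exist (@in_SUH C) _ (su_inv_subproof g).

Fact su_mul_subproof g1 g2 : in_SUH (val g1 *m val g2).
Proof.
have /asboolP[d1 H1] := valP g1; have /asboolP[d2 H2] := valP g2.
by apply/asboolP; split=> [|v w]; rewrite ?det_mulmx ?d1 ?d2 ?mulr1 // -!mulmxA H1 H2.
Qed.
Definition su_mul g1 g2 : SUH C := exist (@in_SUH C) _ (su_mul_subproof g1 g2).

Fact su_mulA : associative su_mul.
Proof. by move=> x y z; apply/val_inj/mulmxA. Qed.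
Fact su_mul1 : left_id su_one su_mul.
Proof. by move=> x; apply/val_inj/mul1mx. Qed.
Fact su_mulr1 : right_id su_one su_mul.
Proof. by move=> x; apply/val_inj/mulmx1. Qed.
Fact su_mulV : left_inverse su_one su_inv su_mul.
Proof. by move=> x; apply/val_inj/mulVmx/SUH_unit. Qed.
Fact su_mulrV : right_inverse su_one su_inv su_mul.
Proof. by move=> x; apply/val_inj/mulmxV/SUH_unit. Qed.

HB.instance Definition _ :=
  isGroup.Build (SUH C) su_mulA su_mul1 su_mulr1 su_mulV su_mulrV.

End SUH.

Section SU3U3.
Variable C : numClosedFieldType.
Implicit Types p q : SU3U3 C.

Fact suu_one_subproof : in_SU3U3 (1%:M : 'M[C]_3, 1%:M).
Proof. by rewrite /in_SU3U3 /= !det1 mulr1 eqxx andbT andbb; apply/unitarymxP; rewrite trmx1 map_mx1 mul1mx. Qed.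
Definition suu_one : SU3U3 C := exist (@in_SU3U3 C) _ suu_one_subproof.

Fact suu_inv_subproof p : in_SU3U3 (invmx (val p).1, invmx (val p).2).
Proof.
have /and3P[u1 u2 /eqP d] := valP p; rewrite /in_SU3U3 /= !det_inv -invfM d invr1 eqxx.
by rewrite !invmx_unitary // !trmxC_unitary u1 u2.
Qed.
Definition suu_inv p : SU3U3 C := exist (@in_SU3U3 C) _ (suu_inv_subproof p).

Fact suu_mul_subproof p q :
  in_SU3U3 ((val p).1 *m (val q).1, (val p).2 *m (val q).2).
Proof.
have /and3P[u1 u2 /eqP d] := valP p; have /and3P[v1 v2 /eqP e] := valP q.
by rewrite /in_SU3U3 /= !mul_unitarymx //= !det_mulmx mulrACA d e mulr1.
Qed.
Definition suu_mul p q : SU3U3 C := exist (@in_SU3U3 C) _ (suu_mul_subproof p q).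

Fact suu_mulA : associative suu_mul.
Proof. by move=> x y z; apply/val_inj; congr pair; exact: mulmxA. Qed.
Fact suu_mul1 : left_id suu_one suu_mul.
Proof. by move=> [[x y] ?]; apply/val_inj; congr pair; exact: mul1mx. Qed.
Fact suu_mulr1 : right_id suu_one suu_mul.
Proof. by move=> [[x y] ?]; apply/val_inj; congr pair; exact: mulmx1. Qed.
Fact suu_mulV : left_inverse suu_one suu_inv suu_mul.
Proof.
move=> x; have /and3P[u1 u2 _] := valP x.
by apply/val_inj; congr pair; apply/mulVmx/unitarymx_unit.
Qed.
Fact suu_mulrV : right_inverse suu_one suu_inv suu_mul.
Proof.
move=> x; have /and3P[u1 u2 _] := valP x.
by apply/val_inj; congr pair; apply/mulmxV/unitarymx_unit.
Qed.

HB.instance Definition _ :=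
  isGroup.Build (SU3U3 C) suu_mulA suu_mul1 suu_mulr1 suu_mulV suu_mulrV.

Fact blockSU_subproof p :
  in_SUH (block_mx (val p).1 0 0 (val p).2 : 'M[C]_(3 + 3)).
Proof.
have /and3P[u1 u2 /eqP d] := valP p; apply/asboolP; split; first exact: etrans (det_lblock _ _ _) d.
have HE (v w : 'cV[C]_(3 + 3)) : Hform v w =
    ((usubmx v) ^t* *m usubmx w - (dsubmx v) ^t* *m dsubmx w) 0 0.
  rewrite /Hform (@big_split_ord _ _ _ 3 3) /= !mxE -sumrN; congr (_ + _).
    by apply: eq_bigr => j _; rewrite /Hsign /= ltn_ord mul1r !mxE.
  by apply: eq_bigr => j _; rewrite /Hsign /= mulN1r mulNr !mxE.
have ku (n : nat) (A : 'M[C]_n) (v w : 'cV[C]_n) : A \is unitarymx ->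
    (A *m v) ^t* *m (A *m w) = v ^t* *m w.
  by move=> uA; rewrite trmx_mul map_mxM -mulmxA [X in _ *m X]mulmxA -invmx_unitary // mulVmx ?mul1mx // unitarymx_unit.
set g := block_mx _ _ _ _.
have gE (v : 'cV[C]_(3 + 3)) :
    g *m v = col_mx ((val p).1 *m usubmx v) ((val p).2 *m dsubmx v).
  by rewrite -[v in LHS]vsubmxK mul_block_col !mul0mx addr0 add0r.
move=> v w; rewrite [LHS](HE (g *m v) (g *m w)) [RHS](HE v w) !gE.
by rewrite !col_mxKu !col_mxKd !ku.
Qed.

Definition blockSU p : SUH C := exist (@in_SUH C) _ (blockSU_subproof p).

End SU3U3.

Section Actions.
Variables (G : groupType) (T : Type) (act : G -> T -> T).
Local Open Scope group_scope.

Definition action_on_set (S : set T) : Prop :=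
  [/\ forall g x, S x -> S (act g x),
      forall x, S x -> act 1 x = x &
      forall g1 g2 x, S x -> act (g1 * g2) x = act g1 (act g2 x)].

Definition act_stabilizer (x : T) : set G := [set g | act g x = x].

Definition ltranslate (g : G) (A : set G) : set G := [set g * a | a in A].

Definition left_cosets (K : set G) : set (set G) :=
  [set ltranslate g K | g in [set: G]].

(** S is G/K as a set with an action of G: a G-equivariant bijection. *)
Definition homogeneous_space (K : set G) (S : set T) : Prop :=
  exists phi : set G -> T, set_bij (left_cosets K) S phi /\
    forall g A, left_cosets K A -> phi (ltranslate g A) = act g (phi A).

Definition isog_to (A : set G) (H : groupType) : Prop :=
  exists f : H -> G,
    [/\ injective f, {morph f : x y / x * y} & range f = A].

End Actions.

Section Hodge.
Variable R : realType.
Local Notation C := R[i].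

(** L is a Q-subspace of the real vector space C^n such that the natural map
    L (x)_Q R -> C^n is an isomorphism: some Q-basis of L is an R-basis. *)
Definition rational_form n (L : set 'cV[C]_n) : Prop :=
  exists m (b : 'I_m -> 'cV[C]_n),
    L = [set \sum_i ratr (q 0 i) *: b i | q in [set: 'rV[rat]_m]] /\
    forall v, exists! x : 'rV[R]_m, v = \sum_i (x 0 i)%:C%C *: b i.

(** h is a rational Hodge structure of weight k on L, where L (x)_Q R is
    identified with the real vector space underlying C^n: an algebraic
    representation of the real algebraic group C^* such that t in R^* acts as
    t^k. The coordinate ring of C^* is R[a, b, 1 / (a^2 + b^2)], z = a + bi;
    real and imaginary parts of a matrix coefficient are treated together by
    allowing P to have complex coefficients. *)
Record hodge_structure (k n : nat) (L : set 'cV[C]_n)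
    (h : Cstar C -> 'cV[C]_n -> 'cV[C]_n) : Prop := HodgeStructure {
  hodge_rational : rational_form L;
  hodge_Rlinear : forall z (t : R) u v,
    h z (t%:C%C *: u + v) = t%:C%C *: h z u + h z v;
  hodge_one : forall v, h 1%g v = v;
  hodge_mul : forall z1 z2 v, h (z1 * z2)%g v = h z1 (h z2 v);
  hodge_algebraic : forall v i, exists N (P : {poly {poly C}}), forall z,
    h z v i 0 = P.['Re (val z), 'Im (val z)] / `|val z| ^+ (2 * N);
  hodge_weight : forall z (t : R) v, val z = t%:C%C -> h z v = (t ^+ k)%:C%C *: v
}.

Definition Qadjoin (w : C) : set C :=
  [set (map_poly ratr p).[w] | p in [set: {poly rat}]].

(** The third exterior power over K = Q[w] of K^6, inside that of C^6: the
    K-span of the e_t. *)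
Definition ext3K (w : C) : set 'cV[C]_(extdim 3 6) :=
  [set v | forall i, Qadjoin w (v i 0)].

Local Notation rep3 := (Cstar C -> 'M[C]_(extdim 3 6)).

Definition h3 (V : {vspace 'cV[C]_6}) : rep3 := fun z => extpow 3 (hmx V (val z)).

Definition hodge3_moduli : set rep3 := [set h3 V | V in @posSpace C].

Definition conj3 (g : SUH C) (h : rep3) : rep3 :=
  fun z => extpow 3 (val g) *m h z *m invmx (extpow 3 (val g)).

End Hodge.

(* Main.v *)
Require Import Defs.
From mathcomp Require Import all_boot all_order all_algebra.
From mathcomp Require Import all_classical reals.
From mathcomp Require Import complex ring.

(** A Hodge structure h_(3,V) remembers V: applied to z = i, it sends the Pluecker vector of V' to
    a multiple of itself only if J_V preserves V', and a subspace V' stable under J_V on which H is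
    positive has no component along the negative space V^perp. Hence the stabilizer of h_(3,V) is
    that of V. Moreover SU(H) is transitive on positive 3-spaces: an H-orthonormal basis of V and a
    (-H)-orthonormal basis of V^perp form a matrix preserving H, which a scalar of modulus 1 brings
    to determinant 1. Everything reduces to the standard positive space, whose stabilizer consists
    of the block diagonal matrices. *)

Set Implicit Arguments.
Unset Strict Implicit.
Unset Printing Implicit Defensive.

Import Order.TTheory GRing.Theory Num.Theory.
Local Open Scope classical_set_scope.
Local Open Scope ring_scope.
Local Open Scope sesquilinear_scope.

(** * Minors on arbitrary rows; scaling and base change of exterior powers *)

Section ExteriorPower.
Variable F : comNzRingType.

(** A repeated row gives a zero minor, and an injective choice of rows is an increasing one up to a
    permutation, which changes both minors by the same sign. Minors with one row replaced thus
    depend only on the wedge. *)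
Lemma rowsub_minors_eq k n (M M' : 'M[F]_(n, k)) :
  wedge M = wedge M' ->
  forall f : 'I_k -> 'I_n, \det (rowsub f M) = \det (rowsub f M').
Proof.
move=> e f.
have [/injectiveP finj|/injectivePn[i [j ij fij]]] := boolP (injectiveb f); last first.
  by rewrite !(determinant_alternate ij) // => l; rewrite !mxE fij.
have [|s [p fE]] := @incr_of_perm_surj k n [ffun i => f i].
  by move=> i j; rewrite !ffunE; exact: finj.
have fs (N : 'M[F]_(n, k)) : rowsub f N = row_perm p (rowsub (incr_of s) N).
  by apply/matrixP => i j; rewrite !mxE -[f i](ffunE f) fE.
have /colP/(_ s) := e; rewrite !mxE !fs !row_permE !det_mulmx => -> //.
Qed.

Lemma extpowZ k n (a : F) (A : 'M[F]_n) : extpow k (a *: A) = a ^+ k *: extpow k A.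
Proof.
apply/matrixP => i j; rewrite !mxE -detZ; congr (\det _).
by apply/matrixP => x y; rewrite !mxE.
Qed.

End ExteriorPower.

(** Meant for evaluation morphisms of polynomial rings, to show that exterior powers are polynomial
    in the entries. *)
Lemma map_extpow (F G : comNzRingType) (f : {rmorphism F -> G}) k n (A : 'M[F]_n) :
  map_mx f (extpow k A) = extpow k (map_mx f A).
Proof.
apply/matrixP => i j; rewrite !mxE -det_map_mx; congr (\det _).
by apply/matrixP => x y; rewrite !mxE.
Qed.

(** * Subspaces as column spans, and their Pluecker vectors *)

Section ColumnSpaces.
Variable F : fieldType.

Lemma eqmx_mulcol m n (A B : 'M[F]_(m, n)) :
  (forall v : 'cV_n, A *m v = B *m v) -> A = B.
Proof.
by move=> e; apply/matrixP => i j; have /colP/(_ i) := e (delta_mx j 0); rewrite -!colE !mxE.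
Qed.

Lemma mulmx_unit_inj m n (A : 'M[F]_m) (u v : 'M[F]_(m, n)) :
  A \in unitmx -> A *m u = A *m v -> u = v.
Proof. by move=> uA /(congr1 (mulmx (invmx A))); rewrite !mulKmx. Qed.

Definition colspan n k (B : 'M[F]_(n, k)) : {vspace 'cV[F]_n} :=
  limg (linfun (mulmx B : 'cV_k -> 'cV_n)).

Lemma colspanP n k (B : 'M[F]_(n, k)) v :
  reflect (exists x : 'cV_k, v = B *m x) (v \in colspan B).
Proof.
apply: (iffP memv_imgP) => [[x _ ->]|[x ->]]; exists x; rewrite ?memvf ?lfunE //.
Qed.

Lemma mem_colspan n k (B : 'M[F]_(n, k)) (x : 'cV_k) : B *m x \in colspan B.
Proof. by apply/colspanP; exists x. Qed.

Definition colfree n k (B : 'M[F]_(n, k)) := forall x : 'cV_k, B *m x = 0 -> x = 0.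

Lemma dim_colspan n k (B : 'M[F]_(n, k)) : colfree B -> \dim (colspan B) = k.
Proof.
move=> Bfree; rewrite limg_dim_eq ?dimvf /dim /= ?muln1 //.
apply/eqP; rewrite capfv -subv0; apply/subvP => x; rewrite memv_ker lfunE /= => /eqP/Bfree ->.
by rewrite mem0v.
Qed.

Lemma colspanE n k (V : {vspace 'cV[F]_n}) : \dim V = k ->
  exists2 B : 'M[F]_(n, k), colfree B & V = colspan B.
Proof.
move=> dV; subst k.
pose B := \matrix_(i < n, j < \dim V) (vbasis V)`_j i 0.
have BE (x : 'cV_(\dim V)) : B *m x = \sum_j x j 0 *: (vbasis V)`_j.
  by apply/colP => i; rewrite mxE summxE; apply: eq_bigr => j _; rewrite !mxE mulrC.
exists B => [x|].
  rewrite BE => e; apply/colP => j; rewrite mxE.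
  by have /freeP/(_ (fun j => x j 0) e j) := basis_free (vbasisP V).
apply/eqP; rewrite eqEsubv; apply/andP; split; apply/subvP => v.
  move=> /coord_vbasis e; apply/colspanP; exists (\col_j coord (vbasis V) j v).
  by rewrite BE [LHS]e; apply: eq_bigr => j _; rewrite mxE.
case/colspanP => x ->; rewrite BE; apply: rpred_sum => j _; apply: rpredZ.
by apply: vbasis_mem; rewrite mem_nth // size_tuple.
Qed.

Lemma colspan_sub n k l (B : 'M[F]_(n, k)) (P : 'M_(k, l)) : (colspan (B *m P) <= colspan B)%VS.
Proof. by apply/subvP => v /colspanP[x ->]; rewrite -mulmxA mem_colspan. Qed.

Lemma colspan_mulr n k (B : 'M[F]_(n, k)) (P : 'M_k) :
  P \in unitmx -> colspan (B *m P) = colspan B.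
Proof.
move=> uP; apply/eqP; rewrite eqEsubv colspan_sub /=.
by rewrite -{1}[B](mulmxK uP) colspan_sub.
Qed.

(** [B] has a left inverse, and the Cauchy-Binet formula writes the determinant 1 of the product as
    a sum of multiples of the maximal minors of [B], which therefore do not all vanish. *)
Lemma colfree_minor n k (B : 'M[F]_(n, k)) : colfree B ->
  exists s : 'I_(extdim k n), rowsub (incr_of s) B \in unitmx.
Proof.
move=> Bfree; have rB : row_free B^T.
  apply/inj_row_free => x /(congr1 trmx); rewrite trmx_mul trmxK trmx0 => /Bfree /(congr1 trmx).
  by rewrite trmxK trmx0.
have LB : (pinvmx B^T)^T *m B = 1%:M.
  by apply: trmx_inj; rewrite trmx_mul trmxK trmx1 mulmxVp.
apply: contrapT => nB; have := det_mulmx_minors (pinvmx B^T)^T B.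
rewrite LB det1 big1 => [/eqP|s _]; first by rewrite oner_eq0.
have : rowsub (incr_of s) B \notin unitmx by apply/negP => h; apply: nB; exists s.
by rewrite unitmxE unitfE negbK => /eqP ->; rewrite mulr0.
Qed.

(* If the minor of M on the rows s is invertible, the entry (i, j) of M * M_s^-1
   is the quotient by that minor of the minor obtained by replacing the j-th row of s by i. *)
Lemma wedge_colspan n k (M M' : 'M[F]_(n, k)) : colfree M -> wedge M = wedge M' ->
  exists X : 'M[F]_k, M' = M *m X.
Proof.
move=> /colfree_minor[s us] e; have me := rowsub_minors_eq e.
have us' : rowsub (incr_of s) M' \in unitmx by move: us; rewrite !unitmxE me.
pose T (i : 'I_n) (j : 'I_k) : 'I_k -> 'I_n := fun l => if l == j then i else incr_of s l.
have main (N : 'M[F]_(n, k)) : rowsub (incr_of s) N \in unitmx -> forall i j,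
    (N *m invmx (rowsub (incr_of s) N)) i j =
    \det (rowsub (T i j) N) / \det (rowsub (incr_of s) N).
  move=> uN i j; set Ns := rowsub _ N; set Q := N *m invmx Ns.
  have Qs : rowsub (incr_of s) Q = 1%:M by rewrite -mul_rowsub_mx mulmxV.
  rewrite -(mulmxKV uN N) -/Ns -/Q -mul_rowsub_mx det_mulmx mulfK; last first.
    by rewrite -unitfE -unitmxE.
  rewrite (expand_det_row _ j).
  (* Outside row j the matrix is the identity, so its cofactors along row j are those of the
     identity, read off from the adjugate. *)
  have adj1 : \adj (1%:M : 'M[F]_k) = 1%:M by rewrite -[LHS]mul1mx mul_mx_adj det1.
  have cofE l : cofactor (rowsub (T i j) Q) j l = (l == j)%:R.
    have := congr1 (fun A : 'M_k => A l j) adj1; rewrite !mxE => <-.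
    congr (_ * \det _); apply/matrixP => a b.
    rewrite !mxE /T eq_sym (negbTE (neq_lift _ _)).
    by have /matrixP/(_ (lift j a) (lift l b)) := Qs; rewrite !mxE.
  rewrite (bigD1 j) //= big1 ?addr0 => [|l lj]; last by rewrite cofE (negbTE lj) mulr0.
  by rewrite cofE eqxx mulr1 [RHS]mxE /T eqxx.
exists (invmx (rowsub (incr_of s) M) *m rowsub (incr_of s) M').
rewrite mulmxA -[LHS](mulmxKV us'); congr (_ *m _); apply/matrixP => i j.
by rewrite !main // !me.
Qed.

End ColumnSpaces.

(** * Hermitian matrices and the Gram matrix of H *)

Section HermitianForms.
Variable C : numClosedFieldType.

Lemma trmxC_mul m n p (A : 'M[C]_(m, n)) (B : 'M_(n, p)) : (A *m B)^t* = B^t* *m A^t*.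
Proof. by rewrite trmx_mul map_mxM. Qed.

Lemma trmxC1 n : (1%:M : 'M[C]_n)^t* = 1%:M.
Proof. by rewrite trmx1 map_mx1. Qed.

Lemma trmxC0 m n : (0 : 'M[C]_(m, n))^t* = 0.
Proof. by rewrite trmx0 map_mx0. Qed.

Lemma trmxCZ m n (a : C) (A : 'M[C]_(m, n)) : (a *: A)^t* = a^* *: A^t*.
Proof. by apply/matrixP => i j; rewrite !mxE rmorphM. Qed.

Lemma trmxC_delta_mul n (A : 'M[C]_n) (i j : 'I_n) :
  ((delta_mx i 0 : 'cV_n)^t* *m A *m (delta_mx j 0 : 'cV_n)) 0 0 = A i j.
Proof.
have -> : (delta_mx i 0 : 'cV[C]_n)^t* = delta_mx 0 i.
  by apply/matrixP => a b; rewrite !mxE rmorph_nat andbC.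
by rewrite -rowE -colE !mxE.
Qed.

(** The spectral theorem gives A = U^* D U with [U] unitary and D diagonal with positive entries;
    take P = U^* D^(-1/2). *)
Lemma posdef_orthonormalize n (A : 'M[C]_n) : A^t* = A ->
  (forall x : 'cV_n, x != 0 -> 0 < (x^t* *m A *m x) 0 0) ->
  exists2 P : 'M[C]_n, P \in unitmx & P^t* *m A *m P = 1%:M.
Proof.
move=> hA posA.
have /orthomx_spectralP : A \is normalmx.
  by apply: hermitian_normalmx; rewrite is_hermitianmxE expr0 scale1r hA.
set U := spectralmx A; set d := spectral_diag A => AE.
have uU : U \is unitarymx := spectral_unitarymx A.
have UU : U *m U^t* = 1%:M by apply/unitarymxP.
have UAU : U *m A *m U^t* = diag_mx d.
  by rewrite AE !mulmxA mulmxV ?unitarymx_unit // mul1mx -mulmxA UU mulmx1.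
(* Positivity is tested on the i-th eigenvector U^* e_i. *)
have d_gt0 i : 0 < d 0 i.
  pose e : 'cV[C]_n := delta_mx i 0; have := posA (U^t* *m e).
  have -> : (U^t* *m e)^t* *m A *m (U^t* *m e) = e^t* *m diag_mx d *m e.
    by rewrite trmxC_mul trmxCK -UAU !mulmxA.
  rewrite trmxC_delta_mul mxE eqxx mulr1n; apply.
  apply/eqP => /(congr1 (mulmx U)); rewrite mulmxA UU mul1mx mulmx0 => /colP/(_ i).
  by rewrite !mxE !eqxx => /eqP; rewrite oner_eq0.
pose r : 'rV_n := \row_i (sqrtC (d 0 i))^-1.
exists (U^t* *m diag_mx r).
  rewrite unitmx_mul unitarymx_unit ?trmxC_unitary //= unitmxE det_diag unitfE.
  by apply/prodf_neq0 => i _; rewrite mxE invr_eq0 sqrtC_eq0 gt_eqF.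
have rr : (diag_mx r)^t* = diag_mx r.
  apply/matrixP => i j; rewrite !mxE rmorphMn /= eq_sym.
  case: eqP => [->|]; rewrite ?mulr0n // !mulr1n.
  by apply: geC0_conj; rewrite invr_ge0 sqrtC_ge0 ltW.
rewrite trmxC_mul trmxCK rr !mulmxA -(mulmxA _ U) -(mulmxA _ (U *m A)) UAU.
apply/matrixP => i j; rewrite mul_mx_diag mul_diag_mx !mxE.
case: eqP => [->|]; rewrite ?mulr0n ?mulr0 ?mul0r // !mulr1n.
rewrite -{2}[d 0 j]sqrtCK expr2.
have s0 : sqrtC (d 0 j) != 0 by rewrite sqrtC_eq0 gt_eqF.
by rewrite mulrA mulVf // mul1r mulfV.
Qed.

(* The block decomposition 6 = 3 + 3 is the splitting of the signs of H. *)
Definition Smx : 'M[C]_6 := block_mx 1%:M 0 0 (- 1%:M) : 'M[C]_(3 + 3).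

Lemma HformE (v w : 'cV[C]_6) : Hform v w = (v^t* *m Smx *m w) 0 0.
Proof.
have -> : Smx = diag_mx (\row_j Hsign C j).
  apply/matrixP => i j; rewrite [RHS]mxE [X in _ = X *+ _]mxE.
  case: (@split_ordP 3 3 i) => i' ->; case: (@split_ordP 3 3 j) => j' ->.
  - by rewrite [LHS](@block_mxEul _ 3 3 3 3) mxE (inj_eq (@lshift_inj 3 3)) /Hsign /= ltn_ord.
  - by rewrite [LHS](@block_mxEur _ 3 3 3 3) mxE (@eq_lrshift 3 3).
  - by rewrite [LHS](@block_mxEdl _ 3 3 3 3) mxE (@eq_rlshift 3 3).
  by rewrite [LHS](@block_mxEdr _ 3 3 3 3) !mxE (inj_eq (@rshift_inj 3 3)) /Hsign /= mulNrn.
rewrite mul_mx_diag mxE; apply: eq_bigr => j _; rewrite !mxE; congr (_ * _).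
by rewrite mulrC.
Qed.

Lemma trmxC_Smx : Smx^t* = Smx.
Proof.
apply: etrans (_ : (block_mx 1%:M 0 0 (- 1%:M) : 'M[C]_(3 + 3))^t* = _) _ => //.
rewrite (tr_block_mx (1%:M : 'M[C]_3)) map_block_mx !trmxC0 trmxC1.
by congr block_mx; rewrite linearN /= map_mxN trmxC1.
Qed.

Lemma Smx_unit : Smx *m Smx = 1%:M.
Proof.
apply: etrans (@mulmx_block _ 3 3 3 3 3 3 _ _ _ _ _ _ _ _) _.
by rewrite !mulmx0 !mul0mx !mulmx1 mulNmx mulmxN mulmx1 opprK !addr0 add0r -scalar_mx_block.
Qed.

Lemma mxform_inj n (A B : 'M[C]_n) :
  (forall v w : 'cV_n, (v^t* *m A *m w) 0 0 = (v^t* *m B *m w) 0 0) -> A = B.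
Proof. by move=> e; apply/matrixP => i j; rewrite -trmxC_delta_mul e trmxC_delta_mul. Qed.

Lemma Hform_preservedP (g : 'M[C]_6) :
  (forall v w, Hform (g *m v) (g *m w) = Hform v w) <-> g^t* *m Smx *m g = Smx.
Proof.
have HgE v w : Hform (g *m v) (g *m w) = (v^t* *m (g^t* *m Smx *m g) *m w) 0 0.
  by rewrite HformE trmxC_mul !mulmxA.
split=> [e|e v w]; last by rewrite HgE e HformE.
by apply: mxform_inj => v w; rewrite -HgE e HformE.
Qed.

Lemma SUH_form (g : SUH C) v w : Hform (val g *m v) (val g *m w) = Hform v w.
Proof. by have /asboolP[_] := valP g; apply. Qed.

End HermitianForms.

(** * Positive 3-spaces and their orthogonal complements *)

Section PositiveSpaces.
Variable C : numClosedFieldType.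
Implicit Types (u v w : 'cV[C]_6) (V : {vspace 'cV[C]_6}).

Lemma HformDr u v w : Hform w (u + v) = Hform w u + Hform w v.
Proof. exact: linearD. Qed.

Lemma HformDl u v w : Hform (u + v) w = Hform u w + Hform v w.
Proof. by rewrite HformC HformDr rmorphD /= -!HformC. Qed.

Lemma HformZr a u w : Hform w (a *: u) = a * Hform w u.
Proof. exact: linearZ. Qed.

Lemma HformZl a u w : Hform (a *: u) w = a^* * Hform u w.
Proof. by rewrite HformC HformZr rmorphM /= -HformC. Qed.

Lemma Hform0r w : Hform w 0 = 0.
Proof. exact: linear0. Qed.

Lemma HformBr u v w : Hform w (u - v) = Hform w u - Hform w v.
Proof. exact: linearB. Qed.

Lemma trmxC_mulmx_gt0 n (x : 'cV[C]_n) : x != 0 -> 0 < (x^t* *m x) 0 0.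
Proof.
move=> x0; rewrite mxE.
under eq_bigr do rewrite !mxE mulrC -normCK.
have ge0 i : 0 <= `|x i 0| ^+ 2 by rewrite exprn_ge0.
rewrite lt_neqAle sumr_ge0 // andbT eq_sym; apply: contra x0.
rewrite psumr_eq0 // => /allP e; apply/eqP/colP => i; rewrite mxE.
by have := e i (mem_index_enum i); rewrite expf_eq0 normr_eq0 /= => /eqP.
Qed.

Lemma Hform_blocks u v : Hform u v =
  ((usubmx (u : 'cV_(3 + 3)))^t* *m usubmx (v : 'cV_(3 + 3))) 0 0
  - ((dsubmx (u : 'cV_(3 + 3)))^t* *m dsubmx (v : 'cV_(3 + 3))) 0 0.
Proof.
rewrite /Hform (@big_split_ord _ _ _ 3 3) /= !mxE -sumrN; congr (_ + _).
  by apply: eq_bigr => j _; rewrite /Hsign /= ltn_ord mul1r !mxE.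
by apply: eq_bigr => j _; rewrite /Hsign /= mulN1r mulNr !mxE.
Qed.

Lemma wide_kernel m n (A : 'M[C]_(m, n)) : (m < n)%N ->
  exists2 y : 'cV_n, y != 0 & A *m y = 0.
Proof.
move=> mn; have : kermx A^T != 0.
  rewrite -mxrank_eq0 mxrank_ker subn_eq0 -ltnNge.
  exact: leq_ltn_trans (rank_leq_col _) mn.
case/rowV0Pn => y /sub_kermxP e y0; exists y^T.
  by apply: contra y0 => /eqP/(congr1 trmx); rewrite trmxK trmx0 => /eqP.
by apply: trmx_inj; rewrite trmx_mul trmxK trmx0.
Qed.

Lemma Hframe_colfree n k (a : C) (B : 'M[C]_(n, k)) (S : 'M_n) :
  a != 0 -> B^t* *m S *m B = a%:M -> colfree B.
Proof.
move=> a0 e x Bx; have := congr1 (mulmx (B^t* *m S)) Bx.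
rewrite mulmxA e mul_scalar_mx mulmx0 => /eqP.
by rewrite scaler_eq0 (negbTE a0) => /eqP.
Qed.

Lemma Hform_mulmx k (B N : 'M[C]_(6, k)) (x y : 'cV_k) :
  Hform (B *m x) (N *m y) = (x^t* *m (B^t* *m Smx C *m N) *m y) 0 0.
Proof. by rewrite HformE trmxC_mul !mulmxA. Qed.

(** The Gram matrix of any basis of [V] is positive definite; orthonormalizing it is a change of
    basis, which keeps the span. *)
Lemma pos_frame V : posSpace V ->
  exists2 B : 'M[C]_(6, 3), B^t* *m Smx C *m B = 1%:M & V = colspan B.
Proof.
case=> /colspanE[B Bfree ->] Vpos.
have [|x x0|P uP PE] := @posdef_orthonormalize C 3 (B^t* *m Smx C *m B).
- by rewrite !trmxC_mul trmxCK trmxC_Smx mulmxA.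
- rewrite -Hform_mulmx; apply: Vpos; first exact: mem_colspan.
  by apply: contra x0 => /eqP/Bfree ->.
by exists (B *m P); [rewrite trmxC_mul !mulmxA in PE * | rewrite colspan_mulr].
Qed.

(** In such a frame, H(Bx, Bx) is the standard squared norm of x. *)
Lemma frame_pos (B : 'M[C]_(6, 3)) :
  B^t* *m Smx C *m B = 1%:M -> posSpace (colspan B).
Proof.
move=> e; have Bfree := Hframe_colfree (oner_neq0 C) e.
split=> [|_ /colspanP[x ->] x0]; first exact: dim_colspan.
rewrite Hform_mulmx e mulmx1; apply: trmxC_mulmx_gt0.
by apply: contra x0 => /eqP ->; rewrite mulmx0.
Qed.

(* A 4-dimensional space V + <v> meets the negative space of dimension 3 spanned by the last
   three basis vectors, so that H cannot be semidefinite on it. *)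
Lemma orthv_neg V v : posSpace V -> v \in orthv V -> v != 0 -> Hform v v < 0.
Proof.
move=> Vpos /mem_orthv vV v0.
have [B Bfree VE] : exists2 B : 'M[C]_(6, 3), colfree B & V = colspan B.
  by apply: colspanE; case: Vpos.
have vreal : Hform v v \is Num.real by rewrite CrealE -HformC.
rewrite real_ltNge ?real0 //; apply/negP => vge0.
(* The first three coordinates of u = Bx + cv are A applied to (x, c), so a kernel vector of this 3
   x 4 matrix puts [u] in the negative space. *)
pose A : 'M[C]_(3, 3 + 1) := row_mx (usubmx (B : 'M_(3 + 3, 3))) (usubmx (v : 'cV_(3 + 3))).
have [//|y y0 Ay] := wide_kernel A.
pose x := usubmx y; pose c := dsubmx y 0 0; pose u : 'cV_6 := B *m x + c *: v.
have yE : y = col_mx x c%:M by rewrite -mx11_scalar vsubmxK.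
have uu : usubmx (u : 'cV_(3 + 3)) = 0.
  rewrite -Ay yE mul_row_col mul_mx_scalar; apply/colP => i; rewrite !mxE; congr (_ + _).
  by apply: eq_bigr => j _; rewrite !mxE.
have Huu : Hform u u = Hform (B *m x) (B *m x) + `|c| ^+ 2 * Hform v v.
  have Bv : Hform (B *m x) v = 0 by apply: vV; rewrite VE mem_colspan.
  rewrite HformDl !HformDr !HformZl !HformZr Bv [Hform v (B *m x)]HformC Bv rmorph0.
  by rewrite !mulr0 addr0 add0r normCKC mulrA.
have c0v : 0 <= `|c| ^+ 2 * Hform v v by rewrite mulr_ge0 // exprn_ge0.
(* Otherwise H(u, u) > 0, although [u] lies in the negative space. *)
have Bx0 : B *m x = 0.
  apply/eqP/negPn/negP => Bx.
  have : 0 < Hform u u.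
    by rewrite Huu ltr_pwDl //; case: Vpos => _; apply => //; rewrite VE mem_colspan.
  rewrite Hform_blocks uu trmxC0 mul0mx [X in X - _]mxE sub0r oppr_gt0.
  have [->|/trmxC_mulmx_gt0/ltW] := eqVneq (dsubmx (u : 'cV_(3 + 3))) 0.
    by rewrite mulmx0 mxE ltxx.
  by move=> /le_gtF ->.
have c0 : c != 0.
  apply: contra y0 => /eqP c0.
  by rewrite yE (Bfree _ Bx0) c0 -scalemx1 scale0r col_mx0.
(* Now u = cv is a nonzero vector of the negative space, while H(v, v) was assumed nonnegative. *)
have : Hform u u < 0.
  rewrite Hform_blocks uu trmxC0 mul0mx [X in X - _]mxE sub0r oppr_lt0.
  apply: trmxC_mulmx_gt0; apply: contra v0 => /eqP du.
  have : u = 0 := etrans (esym (@vsubmxK _ 3 3 1 u)) (etrans (congr2 _ uu du) (col_mx0 _ _ _ _)).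
  by rewrite /u Bx0 add0r => /eqP; rewrite scaler_eq0 (negbTE c0).
by rewrite Huu Bx0 Hform0r add0r le_gtF.
Qed.

(** For an H-orthonormal basis [B] of [V] and the Gram matrix S of H, the vector B B^* S v is the
    orthogonal projection of [v] on [V]. *)
Lemma orthv_decomp V v : posSpace V ->
  exists a b, [/\ a \in V, b \in orthv V & v = a + b].
Proof.
move=> /pos_frame[B e ->]; pose a := B *m (B^t* *m Smx C *m v).
exists a, (v - a); split; rewrite ?subrKC ?mem_colspan //.
apply/mem_orthv => _ /colspanP[x ->].
rewrite HformBr Hform_mulmx e mulmx1 HformE trmxC_mul !mulmxA; exact: subrr.
Qed.

Lemma dim_orthv V : posSpace V -> \dim (orthv V) = 3.
Proof.
move=> Vpos; have := dimv_disjoint_sum (posSpace_capv Vpos).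
have -> : (V + orthv V = fullv)%VS.
  apply/eqP; rewrite eqEsubv subvf; apply/subvP => v _.
  by have [a [b [aV bV ->]]] := orthv_decomp v Vpos; exact: memv_add.
case: Vpos => -> _; rewrite dimvf /dim /= muln1 => /eqP.
by rewrite (@eqn_add2l 3 3) eq_sym => /eqP.
Qed.

(** Same change of basis as for [pos_frame], applied to -H, which is positive definite on the
    orthogonal of [V] by [orthv_neg]. *)
Lemma neg_frame V : posSpace V ->
  exists2 B : 'M[C]_(6, 3), B^t* *m Smx C *m B = (-1)%:M & orthv V = colspan B.
Proof.
move=> Vpos; have [B Bfree VE] := colspanE (dim_orthv Vpos).
have [|x x0|P uP PE] := @posdef_orthonormalize C 3 (- (B^t* *m Smx C *m B)).
- by rewrite linearN /= map_mxN !trmxC_mul trmxCK trmxC_Smx mulmxA.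
- rewrite mulmxN mulNmx mxE -Hform_mulmx oppr_gt0; apply: (orthv_neg Vpos).
    by rewrite VE mem_colspan.
  by apply: contra x0 => /eqP/Bfree ->.
exists (B *m P); last by rewrite colspan_mulr.
rewrite raddfN /= -PE mulmxN mulNmx opprK trmxC_mul !mulmxA //.
Qed.

(** [V] and its orthogonal span the whole space. This is the tool for recognizing conjugates of
    J_V. *)
Lemma Jmx_uniq V (A : 'M[C]_6) : posSpace V ->
  (forall v, v \in V -> A *m v = 'i *: v) ->
  (forall v, v \in orthv V -> A *m v = - ('i *: v)) -> A = Jmx V.
Proof.
move=> Vpos AV AW; apply: eqmx_mulcol => v.
have [a [b [aV bW ->]]] := orthv_decomp v Vpos.
by rewrite !mulmxDr AV // AW // Jmx_pos // Jmx_neg.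
Qed.

Lemma Jmx_sqr V : posSpace V -> Jmx V *m Jmx V = - 1%:M.
Proof.
move=> Vpos; apply: eqmx_mulcol => v.
have [a [b [aV bW ->]]] := orthv_decomp v Vpos.
rewrite -mulmxA [Jmx V *m (a + b)]mulmxDr Jmx_pos // Jmx_neg // mulNmx mul1mx.
rewrite mulmxBr -!scalemxAr Jmx_pos // Jmx_neg // scalerN opprK -!scalerDr scalerA.
by rewrite -expr2 sqrCi scaleN1r.
Qed.

(** * Images of subspaces and conjugation of J_V under SU(H) *)

Lemma mem_imv (g : 'M[C]_6) V v :
  reflect (exists2 w, w \in V & v = g *m w) (v \in imv g V).
Proof. by apply: (iffP memv_imgP) => -[w wV ->]; exists w; rewrite ?lfunE. Qed.

Lemma imv1 V : imv 1%:M V = V.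
Proof.
apply/vspaceP => v; apply/mem_imv/idP => [[u uV ->]|vV]; first by rewrite mul1mx.
by exists v; rewrite ?mul1mx.
Qed.

Lemma imvM (A B : 'M[C]_6) V : imv (A *m B) V = imv A (imv B V).
Proof.
apply/vspaceP => v; apply/mem_imv/mem_imv => [[u uV ->]|[_ /mem_imv[u uV ->] ->]].
  by exists (B *m u); rewrite ?mulmxA //; apply/mem_imv; exists u.
by exists u; rewrite // mulmxA.
Qed.

Lemma imv_colspan (g : 'M[C]_6) k (B : 'M_(6, k)) : imv g (colspan B) = colspan (g *m B).
Proof.
apply/eqP; rewrite eqEsubv; apply/andP; split; apply/subvP => v.
  by case/mem_imv => _ /colspanP[x ->] ->; rewrite mulmxA mem_colspan.
by case/colspanP => x ->; apply/mem_imv; exists (B *m x); rewrite ?mem_colspan ?mulmxA.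
Qed.

Lemma posSpace_imv (g : SUH C) V : posSpace V -> posSpace (imv (val g) V).
Proof.
case=> dV Vpos; split=> [|_ /mem_imv[w wV ->] gw]; last first.
  rewrite SUH_form; apply: Vpos => //.
  by apply: contra gw => /eqP ->; rewrite mulmx0.
have [B Bfree VE] := colspanE dV; rewrite VE imv_colspan dim_colspan // => x.
rewrite -mulmxA => gBx; apply: Bfree.
by apply: (mulmx_unit_inj (SUH_unit g)); rewrite gBx mulmx0.
Qed.

Lemma mem_orthv_imv (g : SUH C) V w :
  w \in orthv (imv (val g) V) -> invmx (val g) *m w \in orthv V.
Proof.
move=> /mem_orthv wV; apply/mem_orthv => v vV.
rewrite -(SUH_form g) mulKVmx ?SUH_unit //; apply: wV.
by apply/mem_imv; exists v.
Qed.

(** As [g] preserves H, it carries the orthogonal of [V] to that of [gV]; hence the conjugate of J_V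
    has the eigenspaces that characterize J_(gV). *)
Lemma Jmx_imv (g : SUH C) V : posSpace V ->
  Jmx (imv (val g) V) = val g *m Jmx V *m invmx (val g).
Proof.
move=> Vpos; apply/esym/Jmx_uniq => [|_ /mem_imv[v vV ->]|v /mem_orthv_imv vV].
- exact: posSpace_imv.
- by rewrite -!mulmxA mulKmx ?SUH_unit // Jmx_pos // scalemxAr.
by rewrite -!mulmxA Jmx_neg // mulmxN -scalemxAr mulKVmx ?SUH_unit.
Qed.

Lemma hmx_imv (g : SUH C) V z : posSpace V ->
  hmx (imv (val g) V) z = val g *m hmx V z *m invmx (val g).
Proof.
move=> Vpos; rewrite /hmx Jmx_imv // mulmxDr mulmxDl -!scalemxAr -!scalemxAl mulmx1.
by rewrite mulmxV ?SUH_unit.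
Qed.

(** Since J^2 = -1, sending a + bi to a + bJ is multiplicative. *)
Lemma hmxM V z1 z2 : posSpace V -> hmx V (z1 * z2) = hmx V z1 *m hmx V z2.
Proof.
move=> Vpos; rewrite /hmx mulmxDl !mulmxDr -!scalemxAl -!scalemxAr !mul1mx mulmx1 Jmx_sqr //.
have [-> ->] : 'Re (z1 * z2) = 'Re z1 * 'Re z2 - 'Im z1 * 'Im z2 /\
               'Im (z1 * z2) = 'Re z1 * 'Im z2 + 'Im z1 * 'Re z2.
  have E : z1 * z2 = ('Re z1 * 'Re z2 - 'Im z1 * 'Im z2) +
      'i * ('Re z1 * 'Im z2 + 'Im z1 * 'Re z2).
    rewrite [z1 in LHS]Crect [z2 in LHS]Crect.
    have i2 : 'i * 'i = -1 :> C by rewrite -expr2 sqrCi.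
    by ring: i2.
  by rewrite E Re_rect ?Im_rect ?(realD, realN, realM, Creal_Re, Creal_Im).
rewrite !scalerA scalerBl scalerDl scalerN -!addrA; congr (_ + _).
by rewrite addrC -addrA.
Qed.

Lemma hmxi V : hmx V 'i = Jmx V.
Proof. by rewrite /hmx Re_i Im_i scale0r scale1r add0r. Qed.

(* Both operators act by i^3 on the line Lambda^3 V. *)
Lemma extpow_Jmx_stable V V' v : posSpace V ->
  extpow 3 (Jmx V) = extpow 3 (Jmx V') -> v \in V -> Jmx V' *m v \in V.
Proof.
move=> Vpos e vV; have [B Bfree VE] := colspanE (proj1 Vpos).
have JB : Jmx V *m B = 'i *: B.
  apply: eqmx_mulcol => x; have BxV : B *m x \in V by rewrite VE mem_colspan.
  by rewrite -mulmxA (Jmx_pos Vpos BxV) scalemxAl.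
have iBfree : colfree ('i *: B).
  by move=> x; rewrite -scalemxAl => /eqP; rewrite scaler_eq0 (negbTE (neq0Ci C)) => /eqP/Bfree.
have [X JX] : exists X, Jmx V' *m B = ('i *: B) *m X.
  have wE : wedge ('i *: B) = wedge (Jmx V' *m B).
    rewrite -JB; have h1 := extpow_wedge (Jmx V) B; have h2 := extpow_wedge (Jmx V') B.
    exact: etrans (esym h1) (etrans (congr1 (fun X => X *m _) e) h2).
  exact: wedge_colspan iBfree wE.
move: vV; rewrite VE => /colspanP[x ->].
rewrite mulmxA JX -!scalemxAl -mulmxA; exact: rpredZ (mem_colspan _ _).
Qed.

(* As H is positive on V and negative on the orthogonal of V', the component of v in V along the
   latter, which belongs to V by stability under J_V', vanishes. *)
Lemma extpow_Jmx_inj V V' : posSpace V -> posSpace V' ->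
  extpow 3 (Jmx V) = extpow 3 (Jmx V') -> V = V'.
Proof.
move=> Vpos Vpos' e; have JvV v : v \in V -> Jmx V' *m v \in V := extpow_Jmx_stable Vpos e.
move: {e}JvV => JvV; apply/eqP; rewrite eqEdim.
have -> : \dim V = \dim V' by case: Vpos Vpos' => -> _ [].
rewrite leqnn andbT; apply/subvP => v vV.
have [a [b [aV bV ve]]] := orthv_decomp v Vpos'.
(* From v = a + b with [a] in V' and [b] in its orthogonal, iv - J_(V') v = 2ib. *)
have bVV : b \in V.
  have : 'i *: v - Jmx V' *m v \in V by rewrite rpredB // ?rpredZ // JvV.
  rewrite ve mulmxDr Jmx_pos // Jmx_neg // scalerDr opprD addrACA subrr add0r opprK -scalerDl.
  by rewrite rpredZeq -mulr2n mulrn_eq0 (negbTE (neq0Ci C)).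
have [b0|b0] := eqVneq b 0; first by rewrite ve b0 addr0.
have := orthv_neg Vpos' bV b0; case: Vpos => _ /(_ b bVV b0) /ltW.
by move=> /le_gtF ->.
Qed.

End PositiveSpaces.

(** * Orbits and stabilizers of an action on a set *)

Section Actions.
Variables (G : groupType) (T : Type) (act : G -> T -> T).
Local Open Scope group_scope.

(** Orbit-stabilizer bijection: the coset gK goes to g x0. *)
Lemma action_orbit_homogeneous (S : set T) x0 : action_on_set act S -> S x0 ->
  (forall y, S y -> exists g, act g x0 = y) ->
  homogeneous_space act (act_stabilizer act x0) S.
Proof.
move=> [actS act1 actM] Sx0 trans; set K := act_stabilizer act x0.
(* [xget] chooses a representative of the coset; its default 1 is returned only on the empty set,
   which is not a coset. The image of [x0] is independent of the choice, two representatives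
   differing by an element of [K]. *)
pose phi (A : set G) := act (xget 1 A) x0.
have K1 : K 1 by exact: act1.
have phiE g : phi (ltranslate g K) = act g x0.
  have /(xgetPex 1)[k Kk e] : exists h, ltranslate g K h by exists (g * 1), 1.
  by rewrite /phi -e actM // Kk.
have ltrM g h : ltranslate g (ltranslate h K) = ltranslate (g * h) K.
  apply/seteqP; split=> [_ [_ [k Kk <-] <-]|_ [k Kk <-]].
    by exists k; rewrite ?mulgA.
  by exists (h * k); [exists k | rewrite mulgA].
exists phi; split; last by move=> g _ [h _ <-]; rewrite ltrM !phiE actM.
split=> [_ [g _ <-]|A A' /set_mem[g _ <-] /set_mem[h _ <-]|y Sy].
- by rewrite phiE; exact: actS.
- rewrite !phiE => e.
  (* Equal images mean that b^-1 a fixes [x0], so that ak = b (b^-1 a k) lies in bK. *)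
  have sub a b : act a x0 = act b x0 -> ltranslate a K `<=` ltranslate b K.
    move=> eab _ [k Kk <-]; exists (b^-1 * (a * k)); last by rewrite mulVKg.
    by rewrite /K /act_stabilizer /= !actM // Kk eab -actM // mulVg act1.
  by apply/seteqP; split; exact: sub.
by have [g <-] := trans y Sy; exists (ltranslate g K); [exists g | exact: phiE].
Qed.

(** The stabilizer of g x0 is the conjugate by [g] of that of [x0], so [f] followed by this
    conjugation parametrizes it. *)
Lemma isog_conj_stabilizer (H : groupType) (f : H -> G) (S : set T) x0 (g : G) :
  action_on_set act S -> S x0 -> injective f -> {morph f : x y / x * y} ->
  range f = act_stabilizer act x0 ->
  isog_to (act_stabilizer act (act g x0)) H.
Proof.
move=> [actS act1 actM] Sx0 finj fM fE.
exists (fun p => g * f p * g^-1); split=> [p q /mulIg/mulgI/finj //|p q|].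
  by rewrite fM !mulgA mulgVK.
have stab h : act_stabilizer act (act g x0) h <-> act_stabilizer act x0 (g^-1 * h * g).
  rewrite /act_stabilizer /= -!actM //; split=> e.
    by rewrite -mulgA actM // e -actM // mulVg act1.
  by rewrite -{2}e -actM // !mulgA mulgV mul1g.
apply/seteqP; split=> [_ [p _ <-]|h /stab].
  by apply/stab; rewrite -fE !mulgA mulVg mul1g mulgVK; exists p.
by rewrite -fE => -[p _ e]; exists p => //; rewrite e !mulgA mulgV mul1g mulgK.
Qed.

End Actions.

(** * The standard positive space: its orbit and its stabilizer *)

Section Frames.
Variable C : numClosedFieldType.
Implicit Type V : {vspace 'cV[C]_6}.

Definition stdpos_mx : 'M[C]_(6, 3) := col_mx 1%:M 0 : 'M[C]_(3 + 3, 3).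

Definition stdpos := colspan stdpos_mx.

Lemma block_stdpos_mx (a b c d : 'M[C]_3) :
  (block_mx a b c d : 'M[C]_(3 + 3)) *m stdpos_mx = (col_mx a c : 'M[C]_(3 + 3, 3)).
Proof.
by apply: etrans (@mul_block_col _ 3 3 3 3 _ _ _ _ _ _ _) _; rewrite !mulmx0 !mulmx1 !addr0.
Qed.

Lemma mem_stdpos (v : 'cV[C]_6) :
  v \in stdpos <-> dsubmx (v : 'cV_(3 + 3)) = 0.
Proof.
split=> [/colspanP[x ->]|dv].
  have -> : stdpos_mx *m x = col_mx x (0 : 'cV_3) :> 'cV_(3 + 3).
    by apply: etrans (@mul_col_mx _ 3 3 _ _ _ _ _) _; rewrite mul1mx mul0mx.
  exact: col_mxKd.
apply/colspanP; exists (usubmx (v : 'cV_(3 + 3))).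
apply: etrans (esym (@vsubmxK _ 3 3 1 v)) _; rewrite dv; apply/esym.
by apply: etrans (@mul_col_mx _ 3 3 _ _ _ _ _) _; rewrite mul1mx mul0mx.
Qed.

Lemma stdpos_pos : posSpace stdpos.
Proof.
apply: frame_pos.
have -> : stdpos_mx^t* = row_mx (1%:M : 'M_3) 0 :> 'M_(3, 3 + 3).
  by apply: etrans (congr1 (map_mx _) (@tr_col_mx _ 3 3 _ _ _)) _; rewrite map_row_mx trmxC1 trmxC0.
rewrite -mulmxA block_stdpos_mx.
by apply: etrans (@mul_row_col _ _ 3 3 _ _ _ _ _) _; rewrite !mul1mx mul0mx addr0.
Qed.

Lemma SUH_transitive V : posSpace V -> exists g : SUH C, imv (val g) stdpos = V.
Proof.
move=> Vpos; have [B BB VE] := pos_frame Vpos; have [N NN WE] := neg_frame Vpos.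
have BN : B^t* *m Smx C *m N = 0.
  apply/matrixP => i j; rewrite -trmxC_delta_mul -Hform_mulmx [RHS]mxE.
  have /mem_orthv : N *m delta_mx j 0 \in orthv V by rewrite WE mem_colspan.
  by apply; rewrite VE mem_colspan.
have NB : N^t* *m Smx C *m B = 0.
  by apply: (can_inj (@trmxCK _ _ _)); rewrite !trmxC_mul trmxCK trmxC_Smx mulmxA BN trmxC0.
(* The two frames are mutually orthogonal, so the Gram matrix of the columns of [g0] is again that
   of H. *)
pose g0 : 'M[C]_6 := row_mx B N : 'M_(6, 3 + 3).
have g0S : g0^t* *m Smx C *m g0 = Smx C.
  have -> : g0^t* = col_mx (B^t*) (N^t*) :> 'M_(3 + 3, 6).
    by apply: etrans (congr1 (map_mx _) (@tr_row_mx _ _ 3 3 _ _)) _; rewrite map_col_mx.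
  rewrite (@mul_col_mx _ 3 3); apply: etrans (@mul_col_row _ 3 3 6 3 3 _ _ _ _) _.
  by rewrite BB BN NB NN raddfN.
have detS : \det (Smx C) != 0.
  apply/eqP => d0; have := congr1 determinant (Smx_unit C).
  by rewrite det_mulmx d0 mul0r det1 => /eqP; rewrite eq_sym oner_eq0.
(* Take determinants in [g0S] and cancel the nonzero determinant of [Smx]. *)
have detg : `|\det g0| = 1.
  apply/eqP; rewrite -(@pexpr_eq1 _ _ 2) // normCKC; apply/eqP.
  apply: (mulIf detS); rewrite mul1r -[RHS](congr1 determinant g0S) !det_mulmx.
  by rewrite det_map_mx det_tr mulrAC.
(* Scaling in dimension 6 multiplies the determinant by c^6, hence a sixth root; its modulus 1 keeps
   H invariant. *)
have [c c6 cn] : exists2 c : C, c ^+ 6 * \det g0 = 1 & `|c| = 1.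
  have dg : \det g0 != 0 by rewrite -normr_eq0 detg oner_eq0.
  exists (6.-root (\det g0)^-1); first by rewrite rootCK // mulVf.
  by apply/eqP; rewrite -(@pexpr_eq1 _ _ 6) // -normrX rootCK // normfV detg invr1.
have gP : in_SUH (c *: g0).
  apply/asboolP; split; first by rewrite detZ.
  apply/Hform_preservedP; rewrite trmxCZ -!scalemxAl -scalemxAr scalerA g0S.
  by rewrite -normCKC cn expr1n scale1r.
exists (exist (@in_SUH C) _ gP) => /=; rewrite imv_colspan VE -scalemxAl.
have -> : g0 *m stdpos_mx = B.
  by apply: etrans (@mul_row_col _ _ 3 3 _ _ _ _ _) _; rewrite mulmx1 mulmx0 addr0.
rewrite -mul_mx_scalar colspan_mulr // unitmxE det_scalar unitfE expf_neq0 //.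
by rewrite -normr_eq0 cn oner_eq0.
Qed.

Lemma blockSUM : {morph @blockSU C : p q / (p * q)%g}.
Proof.
move=> p q; apply/val_inj/esym.
by apply: etrans (@mulmx_block _ 3 3 3 3 3 3 _ _ _ _ _ _ _ _) _; rewrite !mulmx0 !mul0mx !addr0 add0r.
Qed.

Lemma blockSU_inj : injective (@blockSU C).
Proof.
move=> p q /(congr1 val) /(@eq_block_mx _ 3 3 3 3)[e1 _ _ e2]; apply/val_inj.
by move: e1 e2; case: (val p) (val q) => [a b] [c d] /= -> ->.
Qed.

(** Stability of the standard space kills the lower left block; invariance of H then kills the upper
    right one and makes the diagonal blocks unitary. *)
Lemma blockSU_stab (g : SUH C) :
  imv (val g) stdpos = stdpos <-> range (@blockSU C) g.
Proof.
split=> [gV|[p _ <-]]; last first.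
  have [u1 _ _] := and3P (valP p).
  rewrite imv_colspan [val (blockSU p)]/(block_mx _ _ _ _ : 'M[C]_(3 + 3)) block_stdpos_mx.
  rewrite /stdpos -[RHS](colspan_mulr _ (unitarymx_unit u1)); congr colspan; apply/esym.
  by apply: etrans (@mul_col_mx _ 3 3 _ _ _ _ _) _; rewrite mul1mx mul0mx.
have [a [b [c [d gE]]]] : exists a b c d : 'M[C]_3, val g = (block_mx a b c d : 'M_(3 + 3)).
  by exists (ulsubmx (val g : 'M_(3 + 3))), (ursubmx (val g : 'M_(3 + 3))),
    (dlsubmx (val g : 'M_(3 + 3))), (drsubmx (val g : 'M_(3 + 3))); exact: esym (@submxK _ 3 3 3 3 _).
have c0 : c = 0.
  apply: eqmx_mulcol => x; rewrite mul0mx.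
  have : val g *m (stdpos_mx *m x) \in imv (val g) stdpos.
    by apply/mem_imv; exists (stdpos_mx *m x) => //; exact: mem_colspan.
  rewrite gV => /mem_stdpos; rewrite mulmxA gE block_stdpos_mx => <-; apply/esym.
  by apply: etrans (congr1 dsubmx (@mul_col_mx _ 3 3 _ _ _ _ _)) _; rewrite col_mxKd.
have /asboolP[gdet /Hform_preservedP gS] := valP g.
move: gdet gS; rewrite gE c0 => gdet.
have -> : (block_mx a b 0 d : 'M[C]_(3 + 3))^t* = block_mx (a^t*) 0 (b^t*) (d^t*) :> 'M[C]_(3 + 3).
  by apply: etrans (congr1 (map_mx _) (@tr_block_mx _ 3 3 3 3 _ _ _ _)) _; rewrite map_block_mx trmxC0.
(* Blockwise, invariance of H reads a^* a = 1, a^* b = 0, b^* a = 0 and b^* b - d^* d = -1. *)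
rewrite (@mulmx_block _ 3 3 3 3 3 3) => /(etrans (esym (@mulmx_block _ 3 3 3 3 3 3 _ _ _ _ _ _ _ _))).
move=> /(@eq_block_mx _ 3 3 3 3).
rewrite !(mulmx0, mul0mx, mulmx1, addr0, add0r, mulmxN, mulNmx).
move=> [aa ab _ bd].
have ua : a^t* \is unitarymx by apply/unitarymxP; rewrite trmxCK.
have b0 : b = 0 by apply: (mulmx_unit_inj (unitarymx_unit ua)); rewrite ab mulmx0.
have ud : d^t* \is unitarymx.
  by apply/unitarymxP; rewrite trmxCK; apply: oppr_inj; rewrite -bd b0 mulmx0 add0r.
have pP : in_SU3U3 (a, d).
  rewrite /in_SU3U3 /= -trmxC_unitary ua -trmxC_unitary ud /=; apply/eqP.
  exact: etrans (esym (@det_ublock _ 3 3 _ _ _)) gdet.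
by exists (exist (@in_SU3U3 C) _ pP) => //; apply/val_inj; rewrite [RHS]gE b0 c0.
Qed.

End Frames.

(** * The field K, its rational structure, and the Hodge structures h_3 *)

Section Hodge.
Variable R : realType.
Local Notation C := R[i].
Implicit Type V : {vspace 'cV[C]_6}.

(** X^3 - 1 = (X - 1)(X^2 + X + 1), and [w] differs from 1. *)
Lemma prim3_sqr (w : C) : 3.-primitive_root w -> w ^+ 2 = - 1 - w.
Proof.
move=> hw; have w1 : w != 1.
  by rewrite -[w]expr1 -(prim_order_dvd hw).
have w3 := prim_expr_order hw.
have : (w - 1) * (w ^+ 2 + w + 1) = 0.
  by transitivity (w ^+ 3 - 1); [ring | rewrite w3 subrr].
move=> /eqP; rewrite mulf_eq0 subr_eq0 (negbTE w1) /= => /eqP e.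
by apply/eqP; rewrite -subr_eq0 opprB opprK addrA e.
Qed.

(** A real root a of X^2 + X + 1 would satisfy (a + 1/2)^2 = -3/4. *)
Lemma prim3_Im_neq0 (w : C) : 3.-primitive_root w -> complex.Im w != 0.
Proof.
move=> /prim3_sqr; case: w => a b /= e; apply/eqP => b0; move: e; rewrite {}b0 expr2 => e.
have := congr1 (@complex.Re R) e; rewrite /= mulr0 subr0 => ea.
have : 0 <= (a + 2^-1) ^+ 2 by exact: sqr_ge0.
have -> : (a + 2^-1) ^+ 2 = - (3 / 4) by field: ea.
by rewrite oppr_ge0 leNgt divr_gt0.
Qed.

Lemma QadjoinP (w x : C) : 3.-primitive_root w ->
  Qadjoin w x <-> exists a b : rat, x = ratr a + ratr b * w.
Proof.
move=> /prim3_sqr w2; split=> [[p _ <-]|[a [b ->]]]; last first.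
  exists (a%:P + b *: 'X) => //.
  by rewrite rmorphD /= map_polyC map_polyZ map_polyX !hornerE.
elim/poly_ind: p => [|p c [a [b e]]].
  by exists 0, 0; rewrite !rmorph0 horner0 mul0r addr0.
(* Horner step: (a + bw) w + c = (c - b) + (a - b) w, by w^2 = -1 - w. *)
exists (c - b), (a - b); rewrite rmorphD rmorphM /= map_polyC map_polyX !hornerE e.
by rewrite !rmorphB /=; ring: w2.
Qed.

Lemma Rbasis_prim3 (w z : C) : complex.Im w != 0 -> exists x y : R, z = x%:C%C + y%:C%C * w.
Proof.
case: w z => a b [c d] /= b0; exists (c - d / b * a), (d / b).
by apply/eqP; rewrite eq_complex /= !mul0r !subr0 !addr0 add0r subrK mulfVK ?eqxx.
Qed.

Lemma Rbasis_prim3_inj (w : C) (x y x' y' : R) : complex.Im w != 0 ->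
  x%:C%C + y%:C%C * w = x'%:C%C + y'%:C%C * w -> x = x' /\ y = y'.
Proof.
case: w => a b /= b0 e.
have := congr1 (@complex.Im R) e; rewrite /= !mul0r !addr0 !add0r => /(mulIf b0) yy.
have := congr1 (@complex.Re R) e; rewrite /= !mul0r !subr0 yy => /addIr xx.
by [].
Qed.

(** The pair 1, [w] spans K over Q and is a basis of the complex numbers over the reals, so the
    vectors e_i and w e_i serve for both. *)
Lemma rational_form_Qadjoin n (w : C) : 3.-primitive_root w ->
  rational_form [set v : 'cV[C]_n | forall i, Qadjoin w (v i 0)].
Proof.
move=> hw; have w0 := prim3_Im_neq0 hw.
pose b (j : 'I_(n + n)) : 'cV[C]_n :=
  match fintype.split j with inl i => delta_mx i 0 | inr i => w *: delta_mx i 0 end.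
have bE (f : 'I_(n + n) -> C) i :
    (\sum_j f j *: b j) i 0 = f (lshift n i) + f (rshift n i) * w.
  rewrite big_split_ord /= mxE !summxE; congr (_ + _).
    rewrite (bigD1 i) //= /b (unsplitK (inl i : 'I_n + 'I_n)) big1 => [|j ji].
      by rewrite !mxE !eqxx mulr1 addr0.
    by rewrite (unsplitK (inl j : 'I_n + 'I_n)) !mxE eq_sym (negbTE ji) mulr0.
  rewrite (bigD1 i) //= /b (unsplitK (inr i : 'I_n + 'I_n)) big1 => [|j ji].
    by rewrite !mxE !eqxx mulr1 addr0.
  by rewrite (unsplitK (inr j : 'I_n + 'I_n)) !mxE eq_sym (negbTE ji) !mulr0.
exists (n + n)%N, b; split=> [|v].
  apply/seteqP; split=> [v /= vQ|_ [q _ <-] i]; last first.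
    by apply/(QadjoinP _ hw); exists (q 0 (lshift n i)), (q 0 (rshift n i)); rewrite bE.
  have /choice[f fE] i : exists p : rat * rat, v i 0 = ratr p.1 + ratr p.2 * w.
    by have /(QadjoinP _ hw)[a [c e]] := vQ i; exists (a, c).
  exists (row_mx (\row_i (f i).1) (\row_i (f i).2)) => //.
  by apply/colP => i; rewrite bE row_mxEl row_mxEr !mxE fE.
have /choice[f fE] i : exists p : R * R, v i 0 = p.1%:C%C + p.2%:C%C * w.
  by have [x [y e]] := Rbasis_prim3 (v i 0) w0; exists (x, y).
exists (row_mx (\row_i (f i).1) (\row_i (f i).2)); split.
  by apply/colP => i; rewrite bE row_mxEl row_mxEr !mxE fE.
move=> x /colP vx; rewrite -[RHS]hsubmxK; congr row_mx; apply/rowP => i; rewrite !mxE.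
  by have := vx i; rewrite fE bE => /(Rbasis_prim3_inj w0)[].
by have := vx i; rewrite fE bE => /(Rbasis_prim3_inj w0)[].
Qed.

Lemma hmx_real V (t : R) : hmx V t%:C%C = t%:C%C *: 1%:M.
Proof.
have tr : t%:C%C \is Num.real by rewrite complex_real.
by rewrite /hmx (Creal_ReP _ tr) (Creal_ImP _ tr) scale0r addr0.
Qed.

(* The operator aI + bJ, with b and a as the inner and outer indeterminates. *)
Definition hpoly V : 'M[{poly {poly C}}]_6 :=
  \matrix_(i, j) (((1%:M : 'M[C]_6) i j)%:P%:P * 'X + (Jmx V i j)%:P%:P * 'X%:P).

Lemma extpow_hmx_polynomial V (v : 'cV[C]_(extdim 3 6)) i :
  exists P : {poly {poly C}}, forall z : C,
    (extpow 3 (hmx V z) *m v) i 0 = P.['Re z, 'Im z].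
Proof.
exists ((extpow 3 (hpoly V) *m map_mx polyC (map_mx polyC v)) i 0) => z.
set x := 'Re z; set y := 'Im z; set Q := extpow 3 (hpoly V) *m _.
(* Evaluation in two variables is a composite of two ring morphisms, each of which commutes with
   products and minors. *)
have -> : (Q i 0).[x, y] = map_mx (horner_eval y) (map_mx (horner_eval x%:P) Q) i 0.
  by rewrite !mxE.
rewrite /Q !map_mxM !map_extpow.
have -> : map_mx (horner_eval y) (map_mx (horner_eval x%:P) (hpoly V)) = hmx V z.
  apply/matrixP => k l; rewrite !mxE /horner_eval !hornerE /=.
  by rewrite -/x -/y mulrC [y * _]mulrC.
have -> : map_mx (horner_eval y) (map_mx (horner_eval x%:P) (map_mx polyC (map_mx polyC v))) = v.
  by apply/matrixP => k l; rewrite !mxE /horner_eval !hornerE.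
by [].
Qed.

Lemma h3M V z1 z2 : posSpace V -> h3 V (z1 * z2)%g = h3 V z1 *m h3 V z2.
Proof.
move=> Vpos; have e := hmxM (val z1) (val z2) Vpos.
rewrite /h3 /= e; have h := @extpowM _ 3 _ (hmx V (val z1)) (hmx V (val z2)); exact: h.
Qed.

Lemma hodge_structure_h3 (w : C) V : 3.-primitive_root w -> posSpace V ->
  hodge_structure 3 (ext3K w) (fun z v => h3 V z *m v).
Proof.
move=> hw Vpos; split.
- exact: rational_form_Qadjoin.
- by move=> z t u v; rewrite mulmxDr -scalemxAr.
- move=> v; rewrite /h3 (_ : hmx V _ = 1%:M) ?extpow1 ?mul1mx //.
  by rewrite -[RHS]scale1r; exact: (hmx_real V 1).
- move=> z1 z2 v; have e := congr1 (fun A => A *m v) (h3M z1 z2 Vpos).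
  exact: etrans e (esym (mulmxA _ _ _)).
(* The exponent is 0: the coefficients are polynomials in the real and imaginary parts, without
   denominator. *)
- move=> v i; have [P PE] := extpow_hmx_polynomial V v i.
  by exists 0%N, P => z; rewrite expr0 divr1 PE.
(* A real t acts as the scalar t on C^6, hence as t^3 on the third exterior power. *)
move=> z t v zt; rewrite /h3 zt hmx_real extpowZ extpow1 -scalemxAl mul1mx.
by rewrite rmorphXn.
Qed.

(** * The action of SU(H) on these Hodge structures by conjugation *)

Lemma h3_imv (g : SUH C) V z : posSpace V ->
  h3 (imv (val g) V) z =
    extpow 3 (val g) *m h3 V z *m invmx (extpow 3 (val g)).
Proof.
move=> Vpos; rewrite /h3 hmx_imv // !extpowM; congr (_ *m _).
have gg : extpow 3 (val g) *m extpow 3 (invmx (val g)) = 1%:M.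
  by rewrite -extpowM mulmxV ?SUH_unit // extpow1.
by have [ug _] := mulmx1_unit gg; rewrite -[LHS](mulKmx ug) gg mulmx1.
Qed.

Lemma conj3_h3 (g : SUH C) V : posSpace V -> conj3 g (h3 V) = h3 (imv (val g) V).
Proof. by move=> Vpos; apply/funext => z; rewrite h3_imv. Qed.

Lemma h3_inj V V' : posSpace V -> posSpace V' -> h3 V = h3 V' -> V = V'.
Proof.
move=> Vpos Vpos' e; apply: (extpow_Jmx_inj Vpos Vpos'); rewrite -!hmxi.
have h := congr1 (fun h => h (exist (fun z : C => z != 0) 'i (neq0Ci C))) e; exact: h.
Qed.

(** By [conj3_h3], conjugating h_(3,V) amounts to moving [V], where the laws of an action are
    clear. *)
Lemma conj3_action : action_on_set (@conj3 R) (@hodge3_moduli R).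
Proof.
split=> [g _ [V Vpos <-]|_ [V Vpos <-]|g1 g2 _ [V Vpos <-]].
- by rewrite conj3_h3 //; exists (imv (val g) V) => //; exact: posSpace_imv.
- have e : imv (val (1%g : SUH C)) V = V := imv1 V.
  by rewrite conj3_h3 ?e.
have e : imv (val (g1 * g2)%g) V = imv (val g1) (imv (val g2) V) := imvM _ _ V.
by rewrite !conj3_h3 ?e; do ?exact: posSpace_imv.
Qed.

Lemma range_blockSU :
  range (@blockSU C) = act_stabilizer (@conj3 R) (h3 (stdpos C)).
Proof.
have Vpos := stdpos_pos C; apply/seteqP; split=> g.
  move=> /blockSU_stab gV; rewrite /act_stabilizer /mkset.
  by rewrite (conj3_h3 _ Vpos) gV.
move=> e; have e' := etrans (esym (conj3_h3 g Vpos)) e.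
apply/blockSU_stab; exact: h3_inj (posSpace_imv g Vpos) Vpos e'.
Qed.

End Hodge.

Theorem mainTheorem4 (R : realType) (w : R[i]) (hw : 3.-primitive_root w) :
  [/\ forall V, @posSpace R[i] V ->
        hodge_structure 3 (ext3K w) (fun z v => h3 V z *m v),
      forall (g : SUH R[i]) V, @posSpace R[i] V ->
        posSpace (imv (val g) V) /\
        forall z, h3 (imv (val g) V) z =
          extpow 3 (val g) *m h3 V z *m invmx (extpow 3 (val g)),
      action_on_set (@conj3 R) (@hodge3_moduli R),
      forall V, @posSpace R[i] V ->
        isog_to (act_stabilizer (@conj3 R) (h3 V)) (SU3U3 R[i]) &
      homogeneous_space (@conj3 R) (range (@blockSU R[i])) (@hodge3_moduli R)].

Proof.
have x0 := stdpos_pos R[i]; have S0 : hodge3_moduli (h3 (stdpos R[i])) by exists (stdpos R[i]).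
split.
- by move=> V; exact: hodge_structure_h3.
- by move=> g V Vpos; split=> [|z]; [exact: posSpace_imv | exact: h3_imv].
- exact: conj3_action.
(* By transitivity every stabilizer is conjugate to that of the base point, which is the block
   diagonal group. *)
- move=> V /SUH_transitive[g <-]; rewrite -conj3_h3 //.
  apply: isog_conj_stabilizer (@conj3_action R) S0 _ _ (range_blockSU R).
    exact: blockSU_inj.
  exact: blockSUM.
rewrite range_blockSU; apply: action_orbit_homogeneous S0 _; first exact: conj3_action.
by move=> _ [V /SUH_transitive[g <-] <-]; exists g; rewrite conj3_h3.
Qed.
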